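(* Let $G_A$ and $G_B$ be undirected vertex-labeled invertible graphs without loops on $n$ and $m$ vertices, respectively. Assume that $G_B$ is arbitrarily bridgeable over its first $k_B\ge 1$ vertices $\{1,\dots,k_B\}$. Then $$\Lambda_{HL}(G_C)\le \Lambda^{opt}_{HL}(G_A,G_B)=\overline{\Lambda}^{sir}_{HL}(G_A,G_B)\le \overline{\Lambda}^{sdp}_{HL}(G_A,G_B)\le \Lambda_{HL}(G_A)$$ for any graph $G_C=\mathcal{B}_K(G_A,G_B)$ which is constructed from $G_A$ and $G_B$ by bridging the vertices of $G_A$ to the first $k_B$ vertices of $G_B$ through an $(n,m)$-bipartite graph $G_K$ given by a nonzero $n\times m$ matrix $K$ with entries in $\{0,1\}$ such that $K_{ij}=0$ for $j=k_B+1,\dots,m$ and $i=1,\dots,n$.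
   Context: A graph is invertible if its (symmetric $0/1$) adjacency matrix is invertible. $A$ and $B$ denote the adjacency matrices of $G_A$ and $G_B$. $M\succeq 0$ means that the symmetric matrix $M$ is positive semidefinite; $I$ denotes an identity matrix of the appropriate size. HOMO-LUMO spectral gap: for a graph $G$, $\Lambda_{HL}(G)=\check\lambda^+(G)-\hat\lambda^-(G)$, where $\check\lambda^+(G)\ge 0$ is the smallest nonnegative and $\hat\lambda^-(G)\le 0$ the largest nonpositive eigenvalue of its adjacency matrix. Arbitrarily bridgeable: a graph $G_B$ on $m$ vertices with invertible adjacency matrix $B$ is arbitrarily bridgeable over its first $\{1,\dots,k_B\}$ vertices if the upper-left $k_B\times k_B$ principal submatrix of $B^{-1}$ is the zero matrix. Bridged graph: for an $n\times m$ matrix $K$ with entries in $\{0,1\}$ (describing an $(n,m)$-bipartite graph $G_K$ with adjacency matrix $\begin{pmatrix} 0 & K \\ {K^T} & 0 \end{pmatrix}$), $\mathcal{B}_K(G_A,G_B)$ is the graph on $n+m$ vertices with adjacency matrix $\begin{pmatrix} A & K\\ K^T & B\end{pmatrix}$. Optimization problems. Variables: real $\mu,\eta\ge 0$, a real $n\times m$ matrix $K$, and a real symmetric $m\times m$ matrix $W$. Consider the following constraints: (LMI) $\begin{pmatrix} I-\mu A^{-1} & KB^{-1}\\ B^{-1}K^T & I-\mu B^{-1}+B^{-1}WB^{-1}\end{pmatrix}\succeq 0$ and $\begin{pmatrix} I+\eta A^{-1} & KB^{-1}\\ B^{-1}K^T & I+\eta B^{-1}+B^{-1}WB^{-1}\end{pmatrix}\succeq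 0$; (SUP) $K_{ij}=0$ for $j=k_B+1,\dots,m$, $i=1,\dots,n$, and $\sum_{k,l}K_{kl}\ge 1$. * $\Lambda^{opt}_{HL}(G_A,G_B)$ is the maximum of $\mu+\eta$ subject to (LMI), (SUP), $K_{ij}\in\{0,1\}$ for all $i,j$, and $W=K^TK$. * $\overline{\Lambda}^{sir}_{HL}(G_A,G_B)$ is the maximum of $\mu+\eta$ subject to (LMI), (SUP), $\begin{pmatrix} W & K^T\\ K & I\end{pmatrix}\succeq 0$, $K_{ij}\in\{0,1\}$ for all $i,j$, $W_{ij}\in\{0,1,2,\dots\}$ for all $i,j$, and $W_{jj}=\sum_l K_{lj}$ for all $j$. * $\overline{\Lambda}^{sdp}_{HL}(G_A,G_B)$ is the maximum of $\mu+\eta$ subject to (LMI), (SUP), $\begin{pmatrix} W & K^T\\ K & I\end{pmatrix}\succeq 0$, $0\le K_{ij}\le 1$ for all $i,j$, $W_{ij}\ge 0$ for all $i,j$, and $W_{jj}=\sum_l K_{lj}$ for all $j$. *)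

(* Defs.v *)
From HB Require Import structures.
From mathcomp Require Import all_boot all_order all_algebra.
From mathcomp Require Import boolp classical_sets reals.

Set Implicit Arguments.
Unset Strict Implicit.
Unset Printing Implicit Defensive.

Import Order.TTheory GRing.Theory Num.Theory.
Local Open Scope ring_scope.
Local Open Scope classical_set_scope.

Record graph (n : nat) := Graph {
  edge :> rel 'I_n;
  edge_sym : symmetric edge;
  edge_irr : irreflexive edge }.

Definition adjmx (R : realType) n (G : graph n) : 'M[R]_n :=
  \matrix_(i, j) (G i j)%:R.

Definition invertible (R : realType) n (G : graph n) : Prop :=
  adjmx R G \in unitmx.

Definition has_maximum (R : realType) (S : set R) : Prop :=
  S `&` ubound S !=set0.

(* Both operators return the junk value 0 when there is no extremum. *)
Definition maximum (R : realType) (S : set R) : R := xget 0 (S `&` ubound S).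
Definition minimum (R : realType) (S : set R) : R := xget 0 (S `&` lbound S).

Definition HL_gap (R : realType) n (G : graph n) : R :=
  minimum [set l : R | eigenvalue (adjmx R G) l /\ 0 <= l]
  - maximum [set l : R | eigenvalue (adjmx R G) l /\ l <= 0].

Definition psdmx (R : realType) n (M : 'M[R]_n) : Prop :=
  M^T = M /\ forall x : 'cV[R]_n, 0 <= (x^T *m M *m x) ord0 ord0.

(* Vertices are numbered from 0: the "first k vertices" are the i with i < k. *)
Definition arbitrarily_bridgeable (R : realType) m (G : graph m) (k : nat) :
    Prop :=
  [/\ (k <= m)%N, invertible R G &
      forall i j : 'I_m, (i < k)%N -> (j < k)%N ->
        invmx (adjmx R G) i j = 0].

Definition binarymx (R : realType) n m (K : 'M[R]_(n, m)) : Prop :=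
  forall i j, K i j = 0 \/ K i j = 1.

Definition supported_on_first (R : realType) n m (k : nat)
    (K : 'M[R]_(n, m)) : Prop :=
  forall (i : 'I_n) (j : 'I_m), (k <= j)%N -> K i j = 0.

Section Bridge.
Variables (R : realType) (n m : nat).
Variables (GA : graph n) (GB : graph m) (K : 'M[R]_(n, m)).

Definition bridge_edge : rel 'I_(n + m) := fun u v =>
  match split u, split v with
  | inl i, inl j => GA i j
  | inl i, inr j => K i j == 1
  | inr i, inl j => K j i == 1
  | inr i, inr j => GB i j
  end.

Fact bridge_sym : symmetric bridge_edge.
Proof.
move=> u v; rewrite /bridge_edge.
by case: (split u) => i; case: (split v) => j //; apply: edge_sym.
Qed.

Fact bridge_irr : irreflexive bridge_edge.
Proof.
by move=> u; rewrite /bridge_edge; case: (split u) => i; apply: edge_irr.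
Qed.

Definition bridge : graph (n + m) := Graph bridge_sym bridge_irr.

Lemma adjmx_bridge : binarymx K ->
  adjmx R bridge = block_mx (adjmx R GA) K K^T (adjmx R GB).
Proof.
move=> K01; apply/matrixP => u v; rewrite !mxE /= /bridge_edge.
have K1 i j : (K i j == 1)%:R = K i j :> R.
  case: (K01 i j) => ->; last by rewrite eqxx.
  by rewrite eq_sym oner_eq0.
by case: (split u) => i; rewrite !mxE; case: (split v) => j; rewrite ?mxE ?K1.
Qed.

End Bridge.

Section Problems.
Variables (R : realType) (n m : nat).
Variables (GA : graph n) (GB : graph m) (k : nat).

Local Notation A := (adjmx R GA).
Local Notation B := (adjmx R GB).
Local Notation invA := (invmx A).
Local Notation invB := (invmx B).

Definition LMI (mu eta : R) (K : 'M[R]_(n, m)) (W : 'M[R]_m) : Prop :=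
  psdmx (block_mx
    (1%:M - mu *: invA)    (K *m invB)
    (invB *m K^T)          (1%:M - mu *: invB + invB *m W *m invB)) /\
  psdmx (block_mx
    (1%:M + eta *: invA)   (K *m invB)
    (invB *m K^T)          (1%:M + eta *: invB + invB *m W *m invB)).

Definition SUP (K : 'M[R]_(n, m)) : Prop :=
  supported_on_first k K /\ 1 <= \sum_i \sum_j K i j.

Definition base_feasible (mu eta : R) (K : 'M[R]_(n, m)) (W : 'M[R]_m) :
    Prop :=
  [/\ 0 <= mu, 0 <= eta, W^T = W, LMI mu eta K W & SUP K].

Definition relaxed_coupling (K : 'M[R]_(n, m)) (W : 'M[R]_m) : Prop :=
  psdmx (block_mx W K^T K 1%:M) /\ forall j, W j j = \sum_l K l j.

Definition feasible_opt mu eta K W : Prop :=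
  [/\ base_feasible mu eta K W, binarymx K & W = K^T *m K].

Definition feasible_sir mu eta K W : Prop :=
  [/\ base_feasible mu eta K W, relaxed_coupling K W, binarymx K &
      forall i j, W i j \is a Num.nat].

Definition feasible_sdp mu eta K W : Prop :=
  [/\ base_feasible mu eta K W, relaxed_coupling K W,
      forall i j, 0 <= K i j <= 1 & forall i j, 0 <= W i j].

Definition objective_values
    (feasible : R -> R -> 'M[R]_(n, m) -> 'M[R]_m -> Prop) : set R :=
  [set v | exists mu eta K W, feasible mu eta K W /\ v = mu + eta].

Definition values_opt := objective_values feasible_opt.
Definition values_sir := objective_values feasible_sir.
Definition values_sdp := objective_values feasible_sdp.

Definition Lambda_opt : R := maximum values_opt.
Definition Lambda_sir : R := maximum values_sir.
Definition Lambda_sdp : R := maximum values_sdp.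

End Problems.

Arguments values_opt R {n m} GA GB k.
Arguments values_sir R {n m} GA GB k.
Arguments values_sdp R {n m} GA GB k.
Arguments Lambda_opt R {n m} GA GB k.
Arguments Lambda_sir R {n m} GA GB k.
Arguments Lambda_sdp R {n m} GA GB k.

(* Main.v *)
Require Import Defs.
From mathcomp Require Import all_boot all_order all_algebra.
From mathcomp Require Import ring lra.
From mathcomp Require Import boolp classical_sets reals.
From mathcomp Require Import topology normedtype derive.

(** For an invertible symmetric C with zero diagonal, the smallest nonnegative
    eigenvalue is the largest t with I - tC^-1 positive semidefinite, and the
    same holds for -C; so the HOMO-LUMO gap of a graph is the maximum of
    mu + eta over the two constraints I - mu C^-1 >= 0 and I + eta C^-1 >= 0.
    Arbitrary bridgeability gives K B^-1 K^T = 0, hence the bridged matrix C is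
    congruent to diag(A, B) through Q = [I, K B^-1; 0, I], and Q^T (I - t C^-1) Q
    is the LMI block matrix with W = K^T K.  In the mixed-integer relaxation
    W - K^T K is positive semidefinite (Schur complement) with zero diagonal,
    hence zero.  The upper left block of the LMI bounds the semidefinite
    relaxation by the gap of G_A, and its maximum is attained by compactness. *)

Set Implicit Arguments.
Unset Strict Implicit.

Import Order.TTheory GRing.Theory Num.Theory numFieldNormedType.Exports.
Local Open Scope ring_scope.
Local Open Scope classical_set_scope.

(** * Quadratic forms *)

Definition bilform (R : realType) n (S : 'M[R]_n) (x y : 'cV[R]_n) : R :=
  (x^T *m S *m y) ord0 ord0.

Lemma bilformE (R : realType) n (S : 'M[R]_n) x y :
  bilform S x y = \sum_i \sum_j x i ord0 * S i j * y j ord0.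
Proof.
rewrite /bilform mxE exchange_big /=; apply: eq_bigr => j _.
by rewrite mxE mulr_suml; apply: eq_bigr => i _; rewrite mxE.
Qed.

Lemma bilformDl (R : realType) n (S : 'M[R]_n) x y z :
  bilform S (x + y) z = bilform S x z + bilform S y z.
Proof. by rewrite /bilform linearD !mulmxDl mxE. Qed.

Lemma bilformDr (R : realType) n (S : 'M[R]_n) x y z :
  bilform S z (x + y) = bilform S z x + bilform S z y.
Proof. by rewrite /bilform mulmxDr mxE. Qed.

Lemma bilformZl (R : realType) n (S : 'M[R]_n) a x y :
  bilform S (a *: x) y = a * bilform S x y.
Proof. by rewrite /bilform linearZ /= -!scalemxAl mxE. Qed.

Lemma bilformZr (R : realType) n (S : 'M[R]_n) a x y :
  bilform S x (a *: y) = a * bilform S x y.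
Proof. by rewrite /bilform -scalemxAr mxE. Qed.

Lemma bilformD (R : realType) n (S T : 'M[R]_n) x y :
  bilform (S + T) x y = bilform S x y + bilform T x y.
Proof. by rewrite /bilform mulmxDr mulmxDl mxE. Qed.

Lemma bilformN (R : realType) n (S : 'M[R]_n) x y : bilform (- S) x y = - bilform S x y.
Proof. by rewrite /bilform mulmxN mulNmx mxE. Qed.

Lemma bilformZ (R : realType) n (S : 'M[R]_n) a x y :
  bilform (a *: S) x y = a * bilform S x y.
Proof. by rewrite /bilform -scalemxAr -scalemxAl mxE. Qed.

Lemma bilformC (R : realType) n (S : 'M[R]_n) x y : S^T = S ->
  bilform S x y = bilform S y x.
Proof.
move=> Ssym; rewrite /bilform -[in LHS](trmxK (x^T *m S *m y)) mxE.
by rewrite !trmx_mul trmxK Ssym mulmxA.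
Qed.

Lemma bilform_congr (R : realType) n p (S : 'M[R]_n) (Q : 'M[R]_(n, p)) x y :
  bilform (Q^T *m S *m Q) x y = bilform S (Q *m x) (Q *m y).
Proof. by rewrite /bilform trmx_mul !mulmxA. Qed.

Lemma bilform_delta (R : realType) n (S : 'M[R]_n) i j :
  bilform S (delta_mx i ord0) (delta_mx j ord0) = S i j.
Proof. by rewrite /bilform trmx_delta -rowE -colE !mxE. Qed.

Lemma bilform1_ge0 (R : realType) n (x : 'cV[R]_n) : 0 <= bilform 1%:M x x.
Proof.
rewrite /bilform mulmx1 mxE sumr_ge0 // => i _.
by rewrite mxE -expr2 sqr_ge0.
Qed.

Lemma bilform1_gt0 (R : realType) n (x : 'cV[R]_n) : x != 0 -> 0 < bilform 1%:M x x.
Proof.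
move=> x0; rewrite lt_def bilform1_ge0 andbT; apply: contra x0.
rewrite /bilform mulmx1 mxE psumr_eq0; last by move=> i _; rewrite mxE -expr2 sqr_ge0.
move=> /allP h; apply/eqP/colP => i; rewrite [RHS]mxE.
have := h i (mem_index_enum _); rewrite mxE /= mulf_eq0 orbb.
by move/eqP.
Qed.

(** The constant is the sum of the absolute values of the entries, since [|x_i x_j| <= |x|^2] for
    all [i] and [j]. *)
Lemma bilform_bounded (R : realType) n (S : 'M[R]_n) :
  exists2 c, 0 <= c & forall x, `|bilform S x x| <= c * bilform 1%:M x x.
Proof.
exists (\sum_i \sum_j `|S i j|).
  by apply: sumr_ge0 => i _; apply: sumr_ge0.
move=> x; rewrite bilformE mulr_suml.
apply: le_trans (ler_norm_sum _ _ _) _; apply: ler_sum => i _.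
rewrite mulr_suml; apply: le_trans (ler_norm_sum _ _ _) _.
apply: ler_sum => j _; rewrite !normrM mulrAC mulrC ler_wpM2l //.
have sq k : x k ord0 ^+ 2 <= bilform 1%:M x x.
  rewrite /bilform mulmx1 mxE (bigD1 k) //= mxE -expr2 lerDl sumr_ge0 // => l _.
  by rewrite mxE -expr2 sqr_ge0.
have := sq i; have := sq j; rewrite -normrM => hj hi.
rewrite ler_norml; apply/andP; split.
  have := sqr_ge0 (x i ord0 + x j ord0); rewrite sqrrD; nra.
have := sqr_ge0 (x i ord0 - x j ord0); rewrite sqrrB; nra.
Qed.

Lemma psdmx_congr (R : realType) n p (S : 'M[R]_n) (Q : 'M[R]_(n, p)) :
  psdmx S -> psdmx (Q^T *m S *m Q).
Proof.
move=> [Ssym Spos]; split; first by rewrite !trmx_mul trmxK Ssym mulmxA.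
by move=> x; have := Spos (Q *m x); rewrite -/(bilform _ _ _) -bilform_congr.
Qed.

Lemma psdmx_CauchySchwarz (R : realType) n (S : 'M[R]_n) x y : psdmx S ->
  bilform S x y ^+ 2 <= bilform S x x * bilform S y y.
Proof.
move=> [Ssym Spos].
have pos u v : 0 <= bilform S u u + bilform S v v + 2 * bilform S u v.
  have := Spos (u + v); rewrite -/(bilform _ _ _) bilformDl !bilformDr (bilformC v u) //.
  by rewrite mulr2n mulrDl !mul1r; lra.
have ind a b : 0 <= a ^+ 2 * bilform S x x + b ^+ 2 * bilform S y y
                    + 2 * (a * b) * bilform S x y.
  by have := pos (a *: x) (b *: y); rewrite !bilformZl !bilformZr !expr2; lra.
set p := bilform S x x; set q := bilform S y y; set r := bilform S x y.
have p0 : 0 <= p := Spos x.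
have q0 : 0 <= q := Spos y.
(* The form may be degenerate. If [p = q = 0], the coefficients [(1, 1)] and [(1, -1)] force
   [r = 0]. If [q > 0], the coefficients [(q, -r)] give [q (p q - r^2) >= 0]; the case [p > 0] is
   symmetric. *)
have /predU1P[pe|pp] : (p == 0) || (0 < p) by rewrite -le0r.
  have /predU1P[qe|qq] : (q == 0) || (0 < q) by rewrite -le0r.
    have := ind 1 1; have := ind 1 (-1); rewrite -/p -/q -/r pe qe => h1 h2.
    by have -> : r = 0; [lra | rewrite expr0n mulr0].
  have := ind q (- r); rewrite -/p -/q -/r => h.
  rewrite -subr_ge0 -(pmulr_rge0 _ qq).
  by apply: le_trans h _; rewrite [leLHS](_ : _ = q * (p * q - r ^+ 2)) //; ring.
have := ind (- r) p; rewrite -/p -/q -/r => h.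
rewrite -subr_ge0 -(pmulr_rge0 _ pp).
by apply: le_trans h _; rewrite [leLHS](_ : _ = p * (p * q - r ^+ 2)) //; ring.
Qed.

(** Cauchy-Schwarz at two basis vectors reads [S_ij^2 <= S_ii S_jj]. *)
Lemma psdmx_diag0 (R : realType) n (S : 'M[R]_n) : psdmx S ->
  (forall i, S i i = 0) -> S = 0.
Proof.
move=> Spsd S0; apply/matrixP => i j; rewrite [RHS]mxE.
have := psdmx_CauchySchwarz (delta_mx i ord0) (delta_mx j ord0) Spsd.
rewrite !bilform_delta S0 mul0r => h.
by apply/eqP; rewrite -sqrf_eq0 eq_le h sqr_ge0.
Qed.

(* Cauchy-Schwarz for the form of [S] at [Sx] and [x] bounds [|Sx|^2] by a
   multiple of [x^T S x], and [x] is recovered from [Sx]. *)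
Lemma psdmx_unit_coercive (R : realType) n (S : 'M[R]_n) :
  psdmx S -> S \in unitmx ->
  exists2 c, 0 <= c & forall x, bilform 1%:M x x <= c * bilform S x x.
Proof.
move=> Spsd Su; have [Ssym Spos] := Spsd.
have [c c0 Sc] := bilform_bounded S.
have [d d0 Sd] := bilform_bounded ((invmx S)^T *m 1%:M *m invmx S).
exists (d * c); first exact: mulr_ge0.
move=> x; have Sx := Sd (S *m x).
rewrite bilform_congr mulKmx // in Sx; apply: le_trans (ler_norm _) _.
apply: le_trans Sx _; rewrite -mulrA ler_wpM2l //.
(* With [u = S x] the mixed term is [|u|^2], so [|u|^4 <= (u^T S u) (x^T S x) <= c |u|^2 (x^T S x)],
   and one factor [|u|^2] cancels when [u] is nonzero. *)
set u := S *m x; have := psdmx_CauchySchwarz u x Spsd.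
have -> : bilform S u x = bilform 1%:M u u by rewrite /bilform mulmx1 -mulmxA.
have [->|u0] := eqVneq u 0.
  have -> : bilform 1%:M (0 : 'cV[R]_n) 0 = 0 by rewrite /bilform mulmx0 mxE.
  by move=> _; apply: mulr_ge0 => //; apply: Spos.
have up := bilform1_gt0 u0.
move=> h; rewrite -(ler_pM2l up) -expr2; apply: le_trans h _.
rewrite mulrCA mulrA ler_wpM2r //; first exact: Spos.
exact: le_trans (ler_norm _) (Sc _).
Qed.

(** * The spectral gap as a pair of matrix inequalities *)

(** A least element is unique, so [xget] can only pick [s] and its default 0 is not reached. *)
Lemma minimum_eq (R : realType) (S : set R) s : (S `&` lbound S) s -> minimum S = s.
Proof.
move=> [Ss lb]; rewrite /minimum; case: xgetP => [x _ [Sx lbx]|/(_ s)].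
  by apply/eqP; rewrite eq_le lbx // lb.
by case.
Qed.

Lemma maximum_eq (R : realType) (S : set R) s : (S `&` ubound S) s -> maximum S = s.
Proof.
move=> [Ss lb]; rewrite /maximum; case: xgetP => [x _ [Sx lbx]|/(_ s)].
  by apply/eqP; rewrite eq_le lbx // lb.
by case.
Qed.

Lemma invmx_sym (R : realType) n (C : 'M[R]_n) : C^T = C -> (invmx C)^T = invmx C.
Proof. by move=> Csym; rewrite trmx_inv Csym. Qed.

Lemma unitmxN (R : realType) n (C : 'M[R]_n) : (- C \in unitmx) = (C \in unitmx).
Proof. by rewrite -scaleN1r unitmxZ // unitrN unitr1. Qed.

Lemma invmxN (R : realType) n (C : 'M[R]_n) : C \in unitmx ->
  invmx (- C) = - invmx C.
Proof. by move=> Cu; rewrite -scaleN1r invmxZ ?scaleN1r ?unitmxN // invrN1 scaleN1r. Qed.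

Lemma bilform_pencil (R : realType) n (M : 'M[R]_n) t x :
  bilform (1%:M - t *: M) x x = bilform 1%:M x x - t * bilform M x x.
Proof. by rewrite bilformD bilformN bilformZ. Qed.

(** If [x^T C x <= 0] for all [x], then [-C] is positive semidefinite with zero diagonal, so
    [C = 0], which is singular in positive size. Hence some [x] has [x^T C x > 0], and evaluating
    the pencil at [C x] bounds [t]. *)
Lemma pencil_bounded (R : realType) n (C : 'M[R]_n) : (0 < n)%N ->
  C^T = C -> (forall i, C i i = 0) -> C \in unitmx ->
  exists b, forall t, psdmx (1%:M - t *: invmx C) -> t <= b.
Proof.
move=> n0 Csym C0 Cu.
have [x xC] : exists x, 0 < bilform C x x.
  apply: contrapT => h.
  have C00 : - C = 0.
    apply: psdmx_diag0 => [|i]; last by rewrite mxE C0 oppr0.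
    split; first by rewrite linearN /= Csym.
    move=> x; rewrite -/(bilform _ _ _) bilformN oppr_ge0 leNgt; apply/negP => xC.
    by apply: h; exists x.
  case: n n0 C {Csym C0} Cu h C00 => // n _ C Cu _ C00.
  by move: Cu; rewrite -(opprK C) C00 oppr0 unitmxE det0 unitr0.
exists (bilform 1%:M (C *m x) (C *m x) / bilform C x x) => t [_ /(_ (C *m x))].
rewrite -/(bilform _ _ _) bilform_pencil.
have -> : bilform (invmx C) (C *m x) (C *m x) = bilform C x x.
  by rewrite -bilform_congr Csym mulmxV // mul1mx.
by rewrite subr_ge0 ler_pdivlMr.
Qed.

(* The supremum [s] of the admissible [t] makes the pencil singular: otherwise
   it would be coercive there and [s] could be enlarged. *)
Lemma pencil_min_eigenvalue (R : realType) n (C : 'M[R]_n) : (0 < n)%N ->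
  C^T = C -> (forall i, C i i = 0) -> C \in unitmx ->
  exists s, [/\ ([set l | eigenvalue C l /\ 0 <= l]
                 `&` lbound [set l | eigenvalue C l /\ 0 <= l]) s,
    psdmx (1%:M - s *: invmx C)
    & forall t, psdmx (1%:M - t *: invmx C) -> t <= s].
Proof.
move=> n0 Csym C0 Cu; have [b ub_b] := pencil_bounded n0 Csym C0 Cu.
pose M := invmx C; pose T := [set t | psdmx (1%:M - t *: M)].
have Psym t : (1%:M - t *: M)^T = 1%:M - t *: M.
  by rewrite linearB linearZ /= tr_scalar_mx invmx_sym.
have T0 : T 0.
  split=> // x; rewrite -/(bilform _ _ _) bilform_pencil mul0r subr0.
  exact: bilform1_ge0.
have supT : has_sup T by split; [exists 0 | exists b].
pose s := sup T.
have ub_s t : T t -> t <= s by apply: sup_upper_bound.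
have s0 : 0 <= s by apply: ub_s.
(* Membership in [T] says [t (x^T M x) <= |x|^2] for each [x]. This passes to the supremum when
   [x^T M x > 0], and holds by [s >= 0] otherwise. *)
have Ts : T s.
  split=> // x; rewrite -/(bilform _ _ _) bilform_pencil subr_ge0.
  have [qp|qn] := ltP 0 (bilform M x x); last first.
    by apply: le_trans (bilform1_ge0 x); rewrite mulr_ge0_le0.
  rewrite -ler_pdivlMr //; apply: ge_sup; first by exists 0.
  move=> t [_ /(_ x)]; rewrite -/(bilform _ _ _) bilform_pencil subr_ge0.
  by rewrite ler_pdivlMr.
have sing : (1%:M - s *: M) \notin unitmx.
  apply/negP => /(psdmx_unit_coercive Ts) [c c0 coer].
  have [d d0 Md] := bilform_bounded M.
  have e0 : 0 < 1 + c * d by rewrite ltr_pwDl ?mulr_ge0.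
  (* With [F] the form of the pencil at [s], [|x^T M x| <= d |x|^2 <= c d F]; this [e] makes the
     perturbation [e (x^T M x)] at most [F]. *)
  pose e := (1 + c * d)^-1.
  have : s + e <= s.
    apply: ub_s; split=> // x; rewrite -/(bilform _ _ _) bilform_pencil mulrDl opprD addrA.
    have := coer x; rewrite bilform_pencil; set F := _ - _ => xF.
    have F0 : 0 <= F by have := Ts.2 x; rewrite -/(bilform _ _ _) bilform_pencil.
    rewrite subr_ge0 mulrC ler_pdivrMr //.
    apply: le_trans (ler_norm _) _; apply: le_trans (Md x) _.
    apply: le_trans (ler_wpM2l d0 xF) _.
    by move: F F0 {xF} => F F0; lra.
  by rewrite -subr_ge0 opprD addNKr oppr_ge0 leNgt invr_gt0 e0.
have eigs : eigenvalue C s.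
  rewrite /eigenvalue /eigenspace kermx_eq0 row_free_unit.
  apply: contra sing => Cs.
  (* This factorization transfers singularity of the pencil to [C - s I]. *)
  have -> : 1%:M - s *: M = M *m (C - s%:M).
    by rewrite mulmxBr mulVmx // mul_mx_scalar.
  by rewrite unitmx_mul unitmx_inv Cu.
(* Minimality: an eigenvalue [l >= 0] of [C] is nonzero, so its eigenvector belongs to the
   eigenvalue [1/l] of [M], and the pencil at [s] evaluated there gives [1 - s/l >= 0]. *)
exists s; split=> //; split=> // l [/eigenvalueP[v vC v0] l0].
have l_neq0 : l != 0.
  apply: contraNneq v0 => l00; move: vC; rewrite l00 scale0r => vC.
  by rewrite -(mulmxK Cu v) vC mul0mx.
have lp : 0 < l by rewrite lt_def l_neq0.
have v1 : 0 < bilform 1%:M v^T v^T by apply: bilform1_gt0; rewrite trmx_eq0.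
have := Ts.2 v^T; rewrite -/(bilform _ _ _) bilform_pencil.
have -> : bilform M v^T v^T = l^-1 * bilform 1%:M v^T v^T.
  have vM : v *m M = l^-1 *: v.
    rewrite -[v in LHS](scalerK l_neq0) -vC -scalemxAl mulmxK //.
  by rewrite /bilform trmxK vM -scalemxAl mulmx1 mxE.
rewrite mulrA -[X in X - _]mul1r -mulrBl pmulr_lge0 // subr_ge0.
by rewrite ler_pdivrMr // mul1r.
Qed.

Lemma adjmx_sym (R : realType) n (G : graph n) : (adjmx R G)^T = adjmx R G.
Proof. by apply/matrixP => i j; rewrite !mxE edge_sym. Qed.

(** The preceding lemma is applied to the adjacency matrix and to its negative, whose smallest
    nonnegative eigenvalue is minus the largest nonpositive eigenvalue of the graph. *)
Lemma HL_gapP (R : realType) n (G : graph n) : (0 < n)%N -> invertible R G ->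
  let M := invmx (adjmx R G) in
  exists mu eta,
    [/\ 0 <= mu /\ psdmx (1%:M - mu *: M),
        0 <= eta /\ psdmx (1%:M + eta *: M),
        HL_gap R G = mu + eta,
        forall t, psdmx (1%:M - t *: M) -> t <= mu
      & forall t, psdmx (1%:M + t *: M) -> t <= eta].
Proof.
move=> n0 Gu M; rewrite /invertible in Gu.
have Asym := adjmx_sym R G.
have A0 i : adjmx R G i i = 0 by rewrite mxE edge_irr.
have [mu [mumin mupsd mumax]] := pencil_min_eigenvalue n0 Asym A0 Gu.
have NAsym : (- adjmx R G)^T = - adjmx R G by rewrite linearN /= Asym.
have NA0 i : (- adjmx R G) i i = 0 by rewrite mxE A0 oppr0.
have NGu : - adjmx R G \in unitmx by rewrite unitmxN.
have [eta] := pencil_min_eigenvalue n0 NAsym NA0 NGu.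
have NM t : 1%:M - t *: invmx (- adjmx R G) = 1%:M + t *: M.
  by rewrite invmxN // scalerN opprK.
rewrite NM => -[etamin etapsd etamax].
exists mu, eta; split=> //.
- by split=> //; case: mumin => -[].
- by split=> //; case: etamin => -[].
- rewrite /HL_gap (minimum_eq mumin).
  have eigN l : eigenvalue (- adjmx R G) l = eigenvalue (adjmx R G) (- l).
    apply/eigenvalueP/eigenvalueP => -[v vA v0]; exists v => //.
      by rewrite scaleNr -vA mulmxN opprK.
    by rewrite mulmxN vA scaleNr opprK.
  rewrite (@maximum_eq _ _ (- eta)) ?opprK //.
  have [[eige eta0] lb] := etamin; split; first by rewrite /= -eigN oppr_le0.
  move=> l [eigl l0]; rewrite -lerN2 opprK.
  by apply: lb; rewrite /= eigN opprK oppr_ge0.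
- by move=> t; rewrite -NM; apply: etamax.
Qed.

(** * Bridged graphs and the three problems *)

Lemma psdmx1 (R : realType) n : psdmx (1%:M : 'M[R]_n).
Proof. by split=> [|x]; [rewrite tr_scalar_mx | apply: bilform1_ge0]. Qed.

Lemma psdmx_ulblock (R : realType) n m (P : 'M[R]_n) (S : 'M[R]_(n, m)) T U :
  psdmx (block_mx P S T U) -> psdmx P.
Proof.
move=> /(@psdmx_congr _ _ _ _ (col_mx 1%:M 0)).
rewrite tr_col_mx tr_scalar_mx trmx0 mul_row_block mul_row_col.
by rewrite !mul1mx !mul0mx !mulmx0 !addr0 mulmx1.
Qed.

(** Congruence by the block column [[I; -K]] produces the Schur complement of the identity block. *)
Lemma psdmx_schur (R : realType) n m (W : 'M[R]_m) (K : 'M[R]_(n, m)) :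
  psdmx (block_mx W K^T K 1%:M) -> psdmx (W - K^T *m K).
Proof.
move=> /(@psdmx_congr _ _ _ _ (col_mx 1%:M (- K))).
rewrite tr_col_mx tr_scalar_mx linearN /= mul_row_block mul_row_col.
by rewrite !mul1mx !mulmx1 !mulNmx subrr mul0mx addr0.
Qed.

Lemma psdmx_gram (R : realType) n m (K : 'M[R]_(n, m)) :
  psdmx (block_mx (K^T *m K) K^T K 1%:M).
Proof.
have := psdmx_congr (row_mx K 1%:M) (psdmx1 R n).
by rewrite mulmx1 tr_row_mx mul_col_row !tr_scalar_mx !mul1mx !mulmx1.
Qed.

(** * Block diagonalization of the bridged matrix *)

Section BridgeInverse.
Context {R : realType} {n m : nat} (A : 'M[R]_n) (B : 'M[R]_m) (K : 'M[R]_(n, m)).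
Hypotheses (Au : A \in unitmx) (Bu : B \in unitmx) (Bsym : B^T = B).
Hypothesis KBK : K *m invmx B *m K^T = 0.

Let C := block_mx A K K^T B.
Let Q := block_mx 1%:M (K *m invmx B) 0 1%:M.
Let Qi := block_mx 1%:M (- (K *m invmx B)) 0 1%:M.

Let QQi : Q *m Qi = 1%:M.
Proof.
rewrite mulmx_block !mul1mx !mulmx1 !mul0mx !mulmx0 !addr0 add0r addNr.
by rewrite -scalar_mx_block.
Qed.

(** The upper left block of the product is [A + K B^-1 K^T], which is [A] by the hypothesis
    [KBK]. *)
Let CE : C = Q *m block_mx A 0 0 B *m Q^T.
Proof.
rewrite tr_block_mx !tr_scalar_mx trmx0 trmx_mul invmx_sym // !mulmx_block.
rewrite !(mul1mx, mulmx1, mul0mx, mulmx0, addr0, add0r) mulmxKV //.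
by rewrite mulmxA KBK addr0 mulmxA mulmxV // mul1mx.
Qed.

Let CV : C *m (Qi^T *m block_mx (invmx A) 0 0 (invmx B) *m Qi) = 1%:M.
Proof.
have QiQ : Qi *m Q = 1%:M by apply: mulmx1C.
rewrite CE !mulmxA -(mulmxA _ _ Qi^T) -trmx_mul QiQ trmx1 mulmx1.
rewrite -(mulmxA Q) mulmx_block !(mul0mx, mulmx0, addr0, add0r) !mulmxV //.
by rewrite -scalar_mx_block mulmx1.
Qed.

Lemma bridge_unitmx : C \in unitmx.
Proof. by have [] := mulmx1_unit CV. Qed.

(** [Q^T C^-1 Q] is block diagonal, so the blocks [K B^-1], [B^-1 K^T] and [B^-1 K^T K B^-1] all
    come from [Q^T Q]. *)
Lemma bridge_pencilE t :
  Q^T *m (1%:M - t *: invmx C) *m Q =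
  block_mx (1%:M - t *: invmx A) (K *m invmx B) (invmx B *m K^T)
    (1%:M - t *: invmx B + invmx B *m (K^T *m K) *m invmx B).
Proof.
have -> : invmx C = Qi^T *m block_mx (invmx A) 0 0 (invmx B) *m Qi.
  by rewrite -[RHS](mulKmx bridge_unitmx) CV mulmx1.
have QiQ : Qi *m Q = 1%:M by apply: mulmx1C.
rewrite mulmxBr mulmxBl mulmx1 -scalemxAr -scalemxAl !mulmxA -trmx_mul QiQ.
rewrite trmx1 mul1mx -(mulmxA _ Qi) QiQ mulmx1.
rewrite tr_block_mx !tr_scalar_mx trmx0 trmx_mul invmx_sym // mulmx_block.
rewrite !(mul1mx, mulmx1, mul0mx, mulmx0, addr0, add0r).
rewrite scale_block_mx !scaler0 opp_block_mx !oppr0 add_block_mx !addr0.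
by congr block_mx; rewrite -addrA addrC !mulmxA.
Qed.

Lemma bridge_pencil_psd t :
  psdmx (1%:M - t *: invmx C) <->
  psdmx (block_mx (1%:M - t *: invmx A) (K *m invmx B) (invmx B *m K^T)
    (1%:M - t *: invmx B + invmx B *m (K^T *m K) *m invmx B)).
Proof.
rewrite -bridge_pencilE; split; first exact: psdmx_congr.
move=> /(@psdmx_congr _ _ _ _ Qi); rewrite !mulmxA -trmx_mul QQi trmx1 mul1mx.
by rewrite -mulmxA QQi mulmx1.
Qed.

End BridgeInverse.

(** * Comparison of the three sets of objective values *)

Section Values.
Variables (R : realType) (n m k : nat) (GA : graph n) (GB : graph m).
Hypotheses (GAu : invertible R GA) (GBb : arbitrarily_bridgeable R GB k).

Let GBu : adjmx R GB \in unitmx. Proof. by case: GBb. Qed.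

(** In each term of the product, either an entry of [K] lies outside the first [k] columns and
    vanishes, or the entry of [B^-1] lies in its zero block. *)
Lemma bridgeable_mul0 (K : 'M[R]_(n, m)) : supported_on_first k K ->
  K *m invmx (adjmx R GB) *m K^T = 0.
Proof.
move=> Ks; have [_ _ B0] := GBb; apply/matrixP => i j; rewrite !mxE.
apply: big1 => l _; rewrite !mxE.
have [kl|lk] := leqP k l; first by rewrite (Ks _ _ kl) mulr0.
rewrite big1 ?mul0r // => p _.
have [kp|pk] := leqP k p; first by rewrite (Ks _ _ kp) mul0r.
by rewrite B0 ?mulr0.
Qed.

Lemma LMI_bridge (K : 'M[R]_(n, m)) mu eta : binarymx K ->
  supported_on_first k K ->
  LMI GA GB mu eta K (K^T *m K) <->
  psdmx (1%:M - mu *: invmx (adjmx R (bridge GA GB K))) /\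
  psdmx (1%:M + eta *: invmx (adjmx R (bridge GA GB K))).
Proof.
move=> K01 Ks; rewrite adjmx_bridge //.
have H := bridge_pencil_psd GAu GBu (adjmx_sym R GB)
  (bridgeable_mul0 Ks).
(* The second matrix inequality is the pencil at [t = -eta]. *)
have := H (- eta); rewrite !scaleNr !opprK /LMI => Heta.
by split=> -[/H h1 /Heta h2].
Qed.

Lemma bridge_invertible (K : 'M[R]_(n, m)) : binarymx K ->
  supported_on_first k K -> invertible R (bridge GA GB K).
Proof.
move=> K01 Ks; rewrite /invertible adjmx_bridge //.
by apply: bridge_unitmx => //; [exact: adjmx_sym | exact: bridgeable_mul0].
Qed.

Hypothesis n0 : (0 < n)%N.

Lemma HL_gap_values_opt (K : 'M[R]_(n, m)) : binarymx K -> SUP k K ->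
  values_opt R GA GB k (HL_gap R (bridge GA GB K)).
Proof.
move=> K01 KS; have [Ks _] := KS.
have nm0 : (0 < n + m)%N by rewrite addn_gt0 n0.
have [mu [eta [[mu0 mup] [eta0 etap] -> _ _]]] :=
  HL_gapP nm0 (bridge_invertible K01 Ks).
exists mu, eta, K, (K^T *m K); split=> //; split=> //; split=> //.
  by rewrite trmx_mul trmxK.
exact/LMI_bridge.
Qed.

(** With the preceding lemma, this reduces the exact problem to maximizing the gap of the bridged
    graph over admissible [K]. *)
Lemma values_opt_le (v : R) : values_opt R GA GB k v ->
  exists K : 'M[R]_(n, m), [/\ binarymx K, SUP k K & v <= HL_gap R (bridge GA GB K)].
Proof.
move=> [mu [eta [K [W [[[mu0 eta0 _ L KS] K01 WE] ->]]]]].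
have [Ks _] := KS; exists K; split=> //.
have nm0 : (0 < n + m)%N by rewrite addn_gt0 n0.
have [s [t [_ _ -> sM tM]]] :=
  HL_gapP nm0 (bridge_invertible K01 Ks).
move: L; rewrite WE => /(LMI_bridge _ _ K01 Ks)[/sM ? /tM ?].
exact: lerD.
Qed.

(** Since 0/1 entries are idempotent, [K^T K] has the column sums of [K] on its diagonal. The Schur
    complement [W - K^T K] then has zero diagonal and vanishes. *)
Lemma binary_coupling (K : 'M[R]_(n, m)) W : binarymx K ->
  relaxed_coupling K W <-> W = K^T *m K.
Proof.
move=> K01.
have diagK j : (K^T *m K) j j = \sum_l K l j.
  rewrite mxE; apply: eq_bigr => i _; rewrite mxE.
  by case: (K01 i j) => ->; rewrite ?mulr0 ?mulr1.
split=> [[/psdmx_schur Wpsd Wd]|->]; last by split=> //; apply: psdmx_gram.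
apply/eqP; rewrite -subr_eq0; apply/eqP/psdmx_diag0 => // j.
by rewrite 2!mxE Wd diagK subrr.
Qed.

Lemma values_sir_opt : values_sir R GA GB k = values_opt R GA GB k.
Proof.
apply/seteqP; split=> v [mu [eta [K [W [[]]]]]].
  move=> bf /[swap] K01 /(binary_coupling _ K01) WE _ ->.
  by exists mu, eta, K, W.
move=> bf K01 WE ->; exists mu, eta, K, W; split=> //; split=> //.
  exact/binary_coupling.
(* Integrality of [W] is automatic: its entries are inner products of 0/1 columns. *)
move=> i j; rewrite WE mxE; apply: rpred_sum => l _; rewrite mxE.
by case: (K01 l i) (K01 l j) => -> [] ->; rewrite ?mul0r ?mul1r ?rpred0 ?rpred1.
Qed.

Lemma values_sir_sub_sdp : values_sir R GA GB k `<=` values_sdp R GA GB k.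
Proof.
move=> v [mu [eta [K [W [[bf rc K01 Wn] ->]]]]].
exists mu, eta, K, W; split=> //; split=> // i j.
  by case: (K01 i j) => ->; rewrite ?lexx ?ler01.
exact: natr_ge0.
Qed.

(** The upper left blocks of the two inequalities are the pencils of [G_A] at [mu] and [-eta]. *)
Lemma values_sdp_ub : ubound (values_sdp R GA GB k) (HL_gap R GA).
Proof.
move=> v [mu [eta [K [W [[[_ _ _ [L1 L2] _] _ _ _] ->]]]]].
have [s [t [_ _ -> sM tM]]] := HL_gapP n0 GAu.
by apply: lerD; [apply/sM/psdmx_ulblock/L1 | apply/tM/psdmx_ulblock/L2].
Qed.

Lemma SUP_binary (K : 'M[R]_(n, m)) : binarymx K -> K != 0 ->
  supported_on_first k K -> SUP k K.
Proof.
move=> K01 K0 Ks; split=> //.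
have Kge i j : 0 <= K i j by case: (K01 i j) => ->.
have [i [j Kij]] : exists i, exists j, K i j != 0.
  apply: contrapT => h; move/eqP: K0; apply; apply/matrixP => i j.
  rewrite mxE; apply/eqP; apply: contrapT => /negP Kij; apply: h.
  by exists i, j.
have K1 : K i j = 1 by case: (K01 i j) Kij => ->; rewrite ?eqxx.
rewrite (bigD1 i) //= (bigD1 j) //= K1 -addrA lerDl addr_ge0 //.
  exact: sumr_ge0.
by apply: sumr_ge0 => p _; apply: sumr_ge0.
Qed.

(** There are finitely many binary matrices. They are encoded as boolean matrices, a finite type, on
    which the gap attains a maximum. *)
Lemma has_maximum_opt (K : 'M[R]_(n, m)) : binarymx K -> SUP k K ->
  has_maximum (values_opt R GA GB k).
Proof.
pose mxb (b : 'M[bool]_(n, m)) : 'M[R]_(n, m) := map_mx (fun c : bool => c%:R) b.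
have mxb01 b : binarymx (mxb b).
  by move=> i j; rewrite mxE; case: (b i j); [right | left].
have mxbK (L : 'M[R]_(n, m)) : binarymx L -> mxb (map_mx (fun x => x == 1) L) = L.
  move=> L01; apply/matrixP => i j; rewrite !mxE.
  by case: (L01 i j) => ->; rewrite ?eqxx // eq_sym oner_eq0.
move=> K01 KS; pose P b := `[< SUP k (mxb b) >].
have P0 : P (map_mx (fun x => x == 1) K) by apply/asboolP; rewrite mxbK.
case: (arg_maxP (fun b => HL_gap R (bridge GA GB (mxb b))) P0) => b /asboolP Pb bmax.
exists (HL_gap R (bridge GA GB (mxb b))); split; first exact: HL_gap_values_opt.
move=> v /values_opt_le [L [L01 LS] /le_trans]; apply.
by rewrite -(mxbK _ L01); apply: bmax; apply/asboolP; rewrite mxbK.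
Qed.

End Values.

(** * Compactness of the semidefinite relaxation *)

Section Closed.
Context {R : realType} {X : topologicalType}.
Implicit Types P Q : X -> Prop.

Lemma closed_forall {I : Type} (P : I -> X -> Prop) :
  (forall i, closed [set x | P i x]) -> closed [set x | forall i, P i x].
Proof.
move=> Pcl; rewrite (_ : [set x | _] = \bigcap_i [set x | P i x]).
  exact: closed_bigI.
by apply/seteqP; split=> x Px i => [_|]; exact: Px.
Qed.

Lemma closed_and4 P1 P2 P3 P4 : closed [set x : X | P1 x] ->
  closed [set x | P2 x] -> closed [set x | P3 x] -> closed [set x | P4 x] ->
  closed [set x | [/\ P1 x, P2 x, P3 x & P4 x]].
Proof.
move=> c1 c2 c3 c4; have := closedI c1 (closedI c2 (closedI c3 c4)).
by congr closed; apply/seteqP; split=> x => [[? [? []]]|[]].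
Qed.

Lemma closed_and5 P1 P2 P3 P4 P5 : closed [set x : X | P1 x] ->
  closed [set x | P2 x] -> closed [set x | P3 x] -> closed [set x | P4 x] ->
  closed [set x | P5 x] -> closed [set x | [/\ P1 x, P2 x, P3 x, P4 x & P5 x]].
Proof.
move=> c1 c2 c3 c4 c5; have := closedI c1 (closed_and4 c2 c3 c4 c5).
by congr closed; apply/seteqP; split=> x => [[? []]|[]].
Qed.

Lemma closed_le_fun (f g : X -> R) : continuous f -> continuous g ->
  closed [set x | f x <= g x].
Proof.
move=> fc gc; rewrite (_ : [set x | _] = (fun x => g x - f x) @^-1` [set y | 0 <= y]).
  apply: preimage_closed; last exact: closed_ge.
  by move=> x _; apply: continuousB; [apply: gc | apply: fc].
by apply/seteqP; split=> x /=; rewrite subr_ge0.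
Qed.

Lemma closed_eq_fun (f g : X -> R) : continuous f -> continuous g ->
  closed [set x | f x = g x].
Proof.
move=> fc gc; have := closedI (closed_le_fun fc gc) (closed_le_fun gc fc).
congr closed; apply/seteqP; split=> x /=; last by move=> ->.
by move=> [fg gf]; apply/eqP; rewrite eq_le fg gf.
Qed.

Lemma continuous_sum_fun {I : Type} (r : seq I) (F : I -> X -> R) :
  (forall i, continuous (F i)) -> continuous (fun x => \sum_(i <- r) F i x).
Proof.
by move=> Fc; apply: continuous_big => // -[a b]; apply: continuousD;
  [apply: cvg_fst | apply: cvg_snd].
Qed.

(** Continuity is taken entry by entry, so it reduces to real-valued functions and no topology on
    matrices enters. *)
Definition mxcontinuous {p q} (F : X -> 'M[R]_(p, q)) :=
  forall i j, continuous (fun x => F x i j).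

Lemma mxcontinuous_cst {p q} (M : 'M[R]_(p, q)) : mxcontinuous (fun=> M).
Proof. by move=> i j; apply: cst_continuous. Qed.

Lemma mxcontinuousD {p q} (F G : X -> 'M[R]_(p, q)) :
  mxcontinuous F -> mxcontinuous G -> mxcontinuous (fun x => F x + G x).
Proof.
move=> Fc Gc i j; rewrite (_ : (fun x => _) = (fun x => F x i j + G x i j)).
  by move=> x; apply: continuousD; [apply: Fc | apply: Gc].
by apply/funext => x; rewrite mxE.
Qed.

Lemma mxcontinuousZ {p q} (a : X -> R) (F : X -> 'M[R]_(p, q)) :
  continuous a -> mxcontinuous F -> mxcontinuous (fun x => a x *: F x).
Proof.
move=> ac Fc i j; rewrite (_ : (fun x => _) = (fun x => a x * F x i j)).
  by move=> x; apply: continuousM; [apply: ac | apply: Fc].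
by apply/funext => x; rewrite mxE.
Qed.

Lemma mxcontinuousM {p q r} (F : X -> 'M[R]_(p, q)) (G : X -> 'M[R]_(q, r)) :
  mxcontinuous F -> mxcontinuous G -> mxcontinuous (fun x => F x *m G x).
Proof.
move=> Fc Gc i j.
rewrite (_ : (fun x => _) = (fun x => \sum_l F x i l * G x l j)).
  apply: continuous_sum_fun => l x.
  by apply: continuousM; [apply: Fc | apply: Gc].
by apply/funext => x; rewrite mxE.
Qed.

Lemma mxcontinuousT {p q} (F : X -> 'M[R]_(p, q)) :
  mxcontinuous F -> mxcontinuous (fun x => (F x)^T).
Proof.
move=> Fc i j; rewrite (_ : (fun x => _) = (fun x => F x j i)); first exact: Fc.
by apply/funext => x; rewrite mxE.
Qed.

Lemma mxcontinuous_block {p q r s} (F : X -> 'M[R]_(p, q)) (G : X -> 'M[R]_(p, r))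
    (H : X -> 'M[R]_(s, q)) (J : X -> 'M[R]_(s, r)) :
  mxcontinuous F -> mxcontinuous G -> mxcontinuous H -> mxcontinuous J ->
  mxcontinuous (fun x => block_mx (F x) (G x) (H x) (J x)).
Proof.
move=> Fc Gc Hc Jc i j.
have -> : i = unsplit (split i) by rewrite splitK.
have -> : j = unsplit (split j) by rewrite splitK.
case: (split i) => i'; case: (split j) => j' /=.
- by under eq_fun do rewrite block_mxEul; apply: Fc.
- by under eq_fun do rewrite block_mxEur; apply: Gc.
- by under eq_fun do rewrite block_mxEdl; apply: Hc.
- by under eq_fun do rewrite block_mxEdr; apply: Jc.
Qed.

Lemma closed_mxeq {p q} (F G : X -> 'M[R]_(p, q)) :
  mxcontinuous F -> mxcontinuous G -> closed [set x | F x = G x].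
Proof.
move=> Fc Gc; rewrite (_ : [set x | _] = [set x | forall i j, F x i j = G x i j]).
  by do 2!apply: closed_forall => ?; apply: closed_eq_fun.
by apply/seteqP; split=> x /=; [move=> -> | move=> ?; apply/matrixP].
Qed.

Lemma closed_psdmx {p} (F : X -> 'M[R]_p) :
  mxcontinuous F -> closed [set x | psdmx (F x)].
Proof.
move=> Fc; apply: closedI; first by apply: closed_mxeq => //; apply: mxcontinuousT.
apply: closed_forall => v; apply: closed_le_fun; first exact: cst_continuous.
have vc : mxcontinuous (fun x => v^T *m F x *m v); last exact: vc.
by apply: mxcontinuousM; [apply: mxcontinuousM|]; try apply: mxcontinuous_cst.
Qed.

End Closed.

(** * Attainment of the maximum of the semidefinite relaxation *)

Section Compactness.
Variables (R : realType) (n m k : nat) (GA : graph n) (GB : graph m).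
Hypotheses (GAu : invertible R GA) (n0 : (0 < n)%N).

(** The diagonal entries of [W] are column sums of [K], hence at most [n]. Evaluating [W] at
    [e_i - e_j] gives [2 W_ij <= W_ii + W_jj]. *)
Lemma relaxed_coupling_le (K : 'M[R]_(n, m)) W : relaxed_coupling K W ->
  (forall i j, 0 <= K i j <= 1) -> forall i j, W i j <= n%:R.
Proof.
move=> [/psdmx_ulblock [Wsym Wpos] Wd] K01 i j.
have Wn l : W l l <= n%:R.
  rewrite Wd -[leRHS](_ : \sum_(i < n) 1 = _); last by rewrite sumr_const card_ord.
  by apply: ler_sum => p _; case/andP: (K01 p l).
have := Wpos (delta_mx i ord0 - delta_mx j ord0).
rewrite -/(bilform _ _ _) -[- delta_mx j _]scaleN1r.
rewrite bilformDl !bilformDr !bilformZl !bilformZr !bilform_delta.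
have -> : W j i = W i j by rewrite -{1}Wsym mxE.
by have := Wn i; have := Wn j; lra.
Qed.

(** One index per scalar unknown: [true] for [mu], [false] for [eta], then the entries of [K] and of
    [W]. Candidate solutions become points of a product of real lines, where Tychonoff's theorem
    applies. *)
Let I : Type := bool + ('I_n * 'I_m + 'I_m * 'I_m).
Let Kof (f : I -> R) : 'M[R]_(n, m) := \matrix_(i, j) f (inr (inl (i, j))).
Let Wof (f : I -> R) : 'M[R]_m := \matrix_(i, j) f (inr (inr (i, j))).
Let feasible (f : I -> R) :=
  feasible_sdp GA GB k (f (inl true)) (f (inl false)) (Kof f) (Wof f).

Let X : topologicalType := {ptws I -> R}.

Let eval_continuous (i : I) : continuous (fun f : X => f i).
Proof. exact: (@proj_continuous _ (fun=> R) i). Qed.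

Let Kof_continuous : @mxcontinuous R X _ _ Kof.
Proof. by move=> i j; under eq_fun do rewrite mxE; apply: eval_continuous. Qed.

Let Wof_continuous : @mxcontinuous R X _ _ Wof.
Proof. by move=> i j; under eq_fun do rewrite mxE; apply: eval_continuous. Qed.

Let mxcontinuous_pencil (t : X -> R) : continuous t ->
  @mxcontinuous R X _ _ (fun f => block_mx
    (1%:M + t f *: invmx (adjmx R GA))    (Kof f *m invmx (adjmx R GB))
    (invmx (adjmx R GB) *m (Kof f)^T)
    (1%:M + t f *: invmx (adjmx R GB)
     + invmx (adjmx R GB) *m Wof f *m invmx (adjmx R GB))).
Proof.
move=> tc.
have cst p q (M : 'M[R]_(p, q)) : @mxcontinuous R X p q (fun=> M).
  exact: mxcontinuous_cst.
apply: mxcontinuous_block.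
- by apply: mxcontinuousD => //; apply: mxcontinuousZ.
- exact: mxcontinuousM.
- by apply: mxcontinuousM => //; apply: mxcontinuousT.
- apply: mxcontinuousD; last by apply: mxcontinuousM => //; apply: mxcontinuousM.
  by apply: mxcontinuousD => //; apply: mxcontinuousZ.
Qed.

Let feasible_closed : closed [set f : X | feasible f].
Proof.
have cst (c : R) : continuous ((fun=> c) : X -> R) by apply: cst_continuous.
apply: closed_and4.
- apply: closed_and5.
  + exact: closed_le_fun.
  + exact: closed_le_fun.
  + by apply: closed_mxeq => //; apply: mxcontinuousT.
  + apply: closedI; apply: closed_psdmx; last exact: mxcontinuous_pencil.
    (* The [mu] inequality is the continuous pencil with coefficient [-mu]. *)
    under eq_fun do rewrite -!scaleNr.
    by apply: mxcontinuous_pencil => f; apply: continuousN; apply: eval_continuous.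
  + apply: closedI; last first.
      by apply: closed_le_fun => //; do 2!apply: continuous_sum_fun => ?.
    by do 3!apply: closed_forall => ?; apply: closed_eq_fun.
- apply: closedI.
    apply: closed_psdmx; apply: mxcontinuous_block => //.
      exact: mxcontinuousT.
  apply: closed_forall => j; apply: closed_eq_fun => //.
  by apply: continuous_sum_fun => l.
- apply: closed_forall => i; apply: closed_forall => j.
  rewrite (_ : [set f | _] = [set f | 0 <= Kof f i j] `&` [set f | Kof f i j <= 1]).
    by apply: closedI; apply: closed_le_fun.
  by apply/seteqP; split=> f /=; [move=> /andP | move=> /andP].
- by do 2!apply: closed_forall => ?; apply: closed_le_fun.
Qed.

Lemma has_maximum_sdp : values_sdp R GA GB k !=set0 ->
  has_maximum (values_sdp R GA GB k).
Proof.
move=> [v0 [mu0 [eta0 [K0 [W0 [feas0 v0E]]]]]].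
have [s [t [[s0 _] [t0 _] _ sM tM]]] := HL_gapP n0 GAu.
(* A common bound for all coordinates: [mu <= s], [eta <= t], entries of [K] at most 1, entries of
   [W] at most [n], all four bounds being nonnegative. *)
pose b := s + t + 1 + n%:R.
pose box : set X := [set f | forall i, `[0, b]%classic (f i)].
have box_compact : compact box.
  by apply: (@tychonoff _ (fun=> R) (fun=> `[0, b]%classic)) => i; apply: segment_compact.
have feasible_box f : feasible f -> box f.
  move=> [[mu_ge0 eta_ge0 _ [L1 L2] _] rc K01 Wge].
  have n_ge0 : 0 <= n%:R :> R by apply: ler0n.
  have smu := sM _ (psdmx_ulblock L1).
  have teta := tM _ (psdmx_ulblock L2).
  case=> [[]|[[i j]|[i j]]]; rewrite /= in_itv /=; apply/andP; split=> //.
  - by rewrite /b; lra.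
  - by rewrite /b; lra.
  - by have := K01 i j; rewrite mxE => /andP[].
  - by have := K01 i j; rewrite mxE => /andP[_]; rewrite /b; lra.
  - by have := Wge i j; rewrite mxE.
  - by have := relaxed_coupling_le rc K01 i j; rewrite mxE /b; lra.
have obj_cont : continuous (fun f : X => f (inl true) + f (inl false) : R).
  by move=> f; apply: continuousD; apply: eval_continuous.
pose encode mu eta (K : 'M[R]_(n, m)) (W : 'M[R]_m) : X := fun i => match i with
  | inl c => if c then mu else eta
  | inr (inl (i, j)) => K i j
  | inr (inr (i, j)) => W i j
  end.
have feasible_encode mu eta K W :
    feasible_sdp GA GB k mu eta K W -> feasible (encode mu eta K W).
  rewrite /feasible; have -> : Kof (encode mu eta K W) = K.
    by apply/matrixP => i j; rewrite mxE.
  by have -> : Wof (encode mu eta K W) = W by apply/matrixP => i j; rewrite mxE.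
have feas_compact : compact (box `&` [set f | feasible f]).
  exact: compact_closedI.
have feas_neq0 : box `&` [set f | feasible f] !=set0.
  exists (encode mu0 eta0 K0 W0); have := feasible_encode _ _ _ _ feas0.
  by split=> //; apply: feasible_box.
have [f] := compact_EVT_max feas_neq0 feas_compact
  (continuous_subspaceT obj_cont).
rewrite inE => -[_ ff] fmax.
exists (f (inl true) + f (inl false)); split.
  by exists (f (inl true)), (f (inl false)), (Kof f), (Wof f).
move=> v [mu [eta [K [W [feas ->]]]]].
have fe := feasible_encode _ _ _ _ feas.
have := fmax (encode mu eta K W); apply; rewrite inE; split=> //.
exact: feasible_box.
Qed.

End Compactness.

(** * Assembly of the chain of inequalities *)

Unset Implicit Arguments.

Theorem theorem5p1 (R : realType) (n m kB : nat)
    (GA : graph n) (GB : graph m)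
    (GA_inv : invertible R GA) (GB_inv : invertible R GB)
    (kB_ge1 : (1 <= kB)%N) (GB_bridgeable : arbitrarily_bridgeable R GB kB)
    (K : 'M[R]_(n, m)) (K_neq0 : K != 0) (K_binary : binarymx K)
    (K_supp : supported_on_first kB K) :
  [/\ has_maximum (values_opt R GA GB kB),
      has_maximum (values_sir R GA GB kB) &
      has_maximum (values_sdp R GA GB kB)] /\
  [/\ HL_gap R (bridge GA GB K) <= Lambda_opt R GA GB kB,
      Lambda_opt R GA GB kB = Lambda_sir R GA GB kB,
      Lambda_sir R GA GB kB <= Lambda_sdp R GA GB kB &
      Lambda_sdp R GA GB kB <= HL_gap R GA].
Proof.
(* A matrix without rows is zero, so [K != 0] forces [n > 0]. *)
have n0 : (0 < n)%N.
  rewrite lt0n; apply: contraNneq K_neq0 => n00; apply/eqP/matrixP => i.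
  by have := ltn_ord i; rewrite {2}n00.
have KS := SUP_binary K_binary K_neq0 K_supp.
have maxS (S : set R) v : (S `&` ubound S) v -> (S `&` ubound S) (maximum S).
  by move=> Sv; rewrite (maximum_eq Sv).
have opt_val := HL_gap_values_opt GA_inv GB_bridgeable n0 K_binary KS.
have opt_max := has_maximum_opt GA_inv GB_bridgeable n0 K_binary KS.
have sir_opt := values_sir_opt R kB GA GB.
have sir_sdp := @values_sir_sub_sdp R n m kB GA GB.
have sdp_max : has_maximum (values_sdp R GA GB kB).
  (* The gap of the given bridged graph shows that the relaxation is feasible. *)
  apply: has_maximum_sdp => //; exists (HL_gap R (bridge GA GB K)).
  by apply: sir_sdp; rewrite sir_opt.
split; first by rewrite sir_opt.
have [x /maxS [opt_in opt_ub]] := opt_max.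
have [y /maxS [sdp_in sdp_ub]] := sdp_max.
rewrite /Lambda_sir sir_opt; split=> //.
- exact: opt_ub.
- by apply: sdp_ub; apply: sir_sdp; rewrite sir_opt.
- exact: (values_sdp_ub GA_inv n0 sdp_in).
Qed.
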